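(* Let $\mathbb{X}$ be a real reflexive Banach space and $\mathbb{Y}$ a real normed space. Let $T \in K(\mathbb{X},\mathbb{Y})$. If $T$ attains its norm at a unique (up to scalar multiplication) vector $x_0 \in S_{\mathbb{X}}$, i.e. $\{x \in S_{\mathbb{X}} : \|Tx\| = \|T\|\} = \{x_0, -x_0\}$, and $Tx_0$ is a smooth point of $\mathbb{Y}$, then $T$ is a smooth point of $K(\mathbb{X},\mathbb{Y})$.
   Context: $S_{\mathbb{X}} = \{x \in \mathbb{X} : \|x\| = 1\}$. $K(\mathbb{X},\mathbb{Y})$ is the normed space of compact linear operators from $\mathbb{X}$ to $\mathbb{Y}$ with the operator norm. A non-zero element $u$ of a real normed space $\mathbb{Z}$ is a smooth point of $\mathbb{Z}$ if there is a unique linear functional $f \in \mathbb{Z}^*$ with $\|f\| = 1$ and $f(u) = \|u\|$. *)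

(* Defs.v *)
From HB Require Import structures.
From mathcomp Require Import all_boot all_order all_algebra.
From mathcomp Require Import all_classical all_reals all_analysis.

Set Implicit Arguments.
Unset Strict Implicit.
Unset Printing Implicit Defensive.

Import Order.TTheory GRing.Theory Num.Theory.
Import numFieldNormedType.Exports.

Local Open Scope classical_set_scope.
Local Open Scope ring_scope.

Definition unit_ball (R : realType) (X : normedModType R) : set X :=
  [set x | `|x| <= 1].

Definition unit_sphere (R : realType) (X : normedModType R) : set X :=
  [set x | `|x| = 1].

Arguments unit_ball {R} X.
Arguments unit_sphere {R} X.

Section bounded_operators.
Context {R : realType} (X Y : normedModType R).

Definition bounded_pred : {pred X -> Y} :=
  fun f => `[< linear f /\ continuous f >].

Record bounded_operator := BoundedOperator {
  operator_fun :> X -> Y;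
  bounded_operatorP : operator_fun \in bounded_pred
}.

HB.instance Definition _ := [isSub for operator_fun].
HB.instance Definition _ := [Choice of bounded_operator by <:].

Lemma bounded_predP (f : X -> Y) :
  reflect (linear f /\ continuous f) (f \in bounded_pred).
Proof. exact: asboolP. Qed.

Lemma bounded_submod_closed : submod_closed bounded_pred.
Proof.
split=> [|a f g /bounded_predP[lf cf] /bounded_predP[lg cg]].
  apply/bounded_predP; split=> [a x y|]; last exact: cst_continuous.
  by rewrite /= scaler0 addr0.
apply/bounded_predP; split=> [b x y|x].
  rewrite -[LHS]/(a *: f (b *: x + y) + g (b *: x + y)).
  rewrite -[RHS]/(b *: (a *: f x + g x) + (a *: f y + g y)).
  rewrite lf lg !scalerDr !scalerA addrACA mulrC.
  by [].
exact: (cvgD (cvgZr (cf x)) (cg x)).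
Qed.

HB.instance Definition _ :=
  GRing.isSubmodClosed.Build R (X -> Y) bounded_pred bounded_submod_closed.
HB.instance Definition _ := [SubChoice_isSubLmodule of bounded_operator by <:].

Lemma bounded_is_linear (f : bounded_operator) : linear f.
Proof. by have /bounded_predP[] := bounded_operatorP f. Qed.

HB.instance Definition _ (f : bounded_operator) :=
  GRing.isLinear.Build R X Y _ f (bounded_is_linear f).

Lemma bounded_continuous (f : bounded_operator) : continuous f.
Proof. by have /bounded_predP[] := bounded_operatorP f. Qed.

(* The closed unit ball, rather than the sphere, gives the right value 0 without
   appealing to [sup set0 = 0] when X is the zero space. *)
Definition opnorm (f : X -> Y) : R := sup [set `|f x| | x in unit_ball X].

Lemma opnorm_has_sup (f : bounded_operator) :
  has_sup [set `|f x| | x in unit_ball X].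
Proof.
split; first by exists `|f 0|, 0 => //=; rewrite /unit_ball/= normr0.
have /bounded_funP /(_ 1)[M fM] : bounded_near f (nbhs (0 : X)).
  by apply/linear_bounded_continuous => /=; exact: bounded_continuous.
by exists M => _ [x /= x1 <-]; exact: fM.
Qed.

Lemma le_opnorm1 (f : bounded_operator) x : `|x| <= 1 -> `|f x| <= opnorm f.
Proof.
move=> x1; apply: sup_upper_bound; first exact: opnorm_has_sup.
by exists x.
Qed.

Lemma opnorm_le (f : bounded_operator) (M : R) :
  (forall x, `|x| <= 1 -> `|f x| <= M) -> opnorm f <= M.
Proof.
move=> fM; apply: ge_sup; first by case: (opnorm_has_sup f).
by move=> _ [x /= x1 <-]; exact: fM.
Qed.

Lemma opnorm_ge0 (f : bounded_operator) : 0 <= opnorm f.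
Proof. by apply: (le_trans (normr_ge0 (f 0))); rewrite le_opnorm1 ?normr0. Qed.

Lemma le_opnorm (f : bounded_operator) x : `|f x| <= opnorm f * `|x|.
Proof.
have [->|x0] := eqVneq x 0; first by rewrite linear0 !normr0 mulr0.
have nx : 0 < `|x| by rewrite normr_gt0.
rewrite -ler_pdivrMr// mulrC.
have -> : `|x|^-1 * `|f x| = `|f (`|x|^-1 *: x)|.
  by rewrite linearZ/= normrZ normfV normr_id.
by apply: le_opnorm1; rewrite normrZ normfV normr_id mulVf ?gt_eqF.
Qed.

Lemma opnormD (f g : bounded_operator) : opnorm (f + g) <= opnorm f + opnorm g.
Proof.
apply: (@opnorm_le (f + g)) => x x1.
by rewrite (le_trans (ler_normD _ _))// lerD ?le_opnorm1.
Qed.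

Lemma opnormZ (a : R) (f : bounded_operator) :
  opnorm (a *: f) = `|a| * opnorm f.
Proof.
have le_Z (b : R) (g : bounded_operator) : opnorm (b *: g) <= `|b| * opnorm g.
  apply: (@opnorm_le (b *: g)) => x x1.
  rewrite -[X in `|X|]/(b *: g x) normrZ.
  by rewrite ler_wpM2l// le_opnorm1.
apply/eqP; rewrite eq_le le_Z/=.
have [->|a0] := eqVneq a 0; last first.
  rewrite -ler_pdivlMl ?normr_gt0// -normfV.
  by have := le_Z a^-1 (a *: f); rewrite scalerA mulVf// scale1r.
by rewrite normr0 mul0r; exact: (@opnorm_ge0 (0 *: f)).
Qed.

Lemma opnorm_eq0 (f : bounded_operator) : opnorm f = 0 -> f = 0.
Proof.
move=> f0; apply: val_inj; apply/funext => x /=.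
by apply/eqP; rewrite -normr_le0 (le_trans (le_opnorm f x))// f0 mul0r.
Qed.

HB.instance Definition _ :=
  Lmodule_isNormed.Build R bounded_operator opnormD opnormZ opnorm_eq0.

Lemma bounded_normE (f : bounded_operator) : `|f| = opnorm f.
Proof. by []. Qed.

End bounded_operators.

Arguments bounded_pred {R X Y}.

Notation "''L' ( X , Y )" := (bounded_operator X Y)
  (at level 8, format "''L' ( X ,  Y )") : type_scope.

Section compact_operators.
Context {R : realType} (X Y : normedModType R).

(* T is compact when the image of the unit ball has compact closure
   ([precompactE]). A linear map with this property is bounded, so nothing is
   lost by carving the compact operators out of 'L(X, Y). *)
Definition compact_pred : {pred 'L(X, Y)} :=
  fun T => `[< precompact (T @` unit_ball X) >].

Record compact_operator := CompactOperator {
  compact_val :> 'L(X, Y);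
  compact_valP : compact_val \in compact_pred
}.

HB.instance Definition _ := [isSub for compact_val].
HB.instance Definition _ := [Choice of compact_operator by <:].

Lemma compact_predP (T : 'L(X, Y)) :
  reflect (precompact (T @` unit_ball X)) (T \in compact_pred).
Proof. exact: asboolP. Qed.

Lemma compact_submod_closed : submod_closed compact_pred.
Proof.
have hY : hausdorff_space Y by exact: norm_hausdorff.
have cptI (T : 'L(X, Y)) (K : set Y) :
    compact K -> T @` unit_ball X `<=` K -> T \in compact_pred.
  by move=> cK TK; apply/compact_predP; exists K => //; split => //;
     exact: compact_closed.
split=> [|a S T /compact_predP[K SK [cK _]] /compact_predP[L TL [cL _]]].
  by apply: (cptI _ [set 0]); [exact: compact_set1|move=> _ [x _ <-]].
pose h (p : Y * Y) := a *: p.1 + p.2.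
apply: (cptI _ (h @` (K `*` L))).
  apply: continuous_compact; last exact: compact_setX.
  apply: continuous_subspaceT => p.
  by apply: cvgD; [apply: cvgZr; exact: cvg_fst|exact: cvg_snd].
move=> _ [x x1 <-]; exists (S x, T x) => //.
by split => /=; [apply: SK|apply: TL]; exists x.
Qed.

HB.instance Definition _ :=
  GRing.isSubmodClosed.Build R 'L(X, Y) compact_pred compact_submod_closed.
HB.instance Definition _ := [SubChoice_isSubLmodule of compact_operator by <:].

Definition compact_norm (T : compact_operator) : R := `|compact_val T|.

Lemma compact_normD (S T : compact_operator) :
  compact_norm (S + T) <= compact_norm S + compact_norm T.
Proof. exact: ler_normD. Qed.

Lemma compact_normZ (a : R) (T : compact_operator) :
  compact_norm (a *: T) = `|a| * compact_norm T.
Proof. exact: normrZ. Qed.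

Lemma compact_norm_eq0 (T : compact_operator) : compact_norm T = 0 -> T = 0.
Proof. by move=> /normr0_eq0 T0; exact: val_inj. Qed.

HB.instance Definition _ := Lmodule_isNormed.Build R compact_operator
  compact_normD compact_normZ compact_norm_eq0.

Lemma compact_normE (T : compact_operator) : `|T| = `|compact_val T|.
Proof. by []. Qed.

End compact_operators.

Arguments compact_pred {R X Y}.

Notation "''K' ( X , Y )" := (compact_operator X Y)
  (at level 8, format "''K' ( X ,  Y )") : type_scope.

(* The dual of Z is 'L(Z, R^o), where R^o is R as a normed space over itself. *)
Definition smooth_point (R : realType) (Z : normedModType R) (u : Z) : Prop :=
  u != 0 /\ exists! f : 'L(Z, R^o), `|f| = 1 /\ f u = `|u|.

Section reflexivity.
Context {R : realType} (X : normedModType R).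

Definition dual_eval (x : X) (f : 'L(X, R^o)) : R^o := f x.

Lemma dual_eval_bounded (x : X) : dual_eval x \in bounded_pred.
Proof.
have lin : linear (dual_eval x) by [].
pose ev : {linear 'L(X, R^o) -> R^o} :=
  HB.pack (dual_eval x) (GRing.isLinear.Build _ _ _ _ _ lin).
apply/bounded_predP; split=> //.
apply: (@bounded_linear_continuous _ _ _ ev); apply/linear_boundedP.
exists `|x|; split=> [|r xr f]; first exact: num_real.
apply: (le_trans (le_opnorm f x)); rewrite [leLHS]mulrC.
exact: (ler_wpM2r (opnorm_ge0 f) (ltW xr)).
Qed.

Definition bidual_embedding (x : X) : 'L('L(X, R^o), R^o) :=
  BoundedOperator (dual_eval_bounded x).

Definition reflexive_space : Prop := range bidual_embedding = setT.

End reflexivity.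

Arguments reflexive_space {R} X.

(* Main.v *)
Require Import Defs.
From HB Require Import structures.
From mathcomp Require Import all_boot all_order all_algebra.
From mathcomp Require Import all_classical all_reals all_analysis.
From mathcomp Require Import lra.

Set Implicit Arguments.
Unset Strict Implicit.
Unset Printing Implicit Defensive.

Import Order.TTheory GRing.Theory Num.Theory.
Import numFieldNormedType.Exports.
Local Open Scope classical_set_scope.
Local Open Scope ring_scope.

(* Let [f] be a norm-one functional on K(X, Y) with [f T = |T|]. For small
   [t > 0] choose [x_t] in the unit ball norming [T + t S] up to [t^2]; then
     |T| + t f(S) - t^2 <= |T x_t + t S x_t| <= |T| + t |S x_t|.
   By reflexivity [x_t] has a weak limit [z] in the unit ball as [t] tends to 0
   along an ultrafilter, and compactness makes [T x_t] and [S x_t] converge in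
   norm to [T z] and [S z]. So [T] attains its norm at [z], hence [z = x0] or
   [z = - x0], and [f S <= |S x0|]. In particular [f S] depends only on [S x0].
   If [g] is the support functional at [T x0] and [phi = g (T .) / |T|], then
   [y |-> f (phi (.) y)] is again a support functional at [T x0], so it is [g],
   and [f S = g (S x0)]. *)

(** * Sublinear functionals and the Hahn-Banach theorem *)

Section hahn_banach.
Context {R : realType} {V : lmodType R}.
Implicit Types (p q : V -> R) (x y : V).

(* Homogeneity is only required as an inequality: applying it to [a^-1] gives
   the converse. *)
Definition sublinear p :=
  (forall x y, p (x + y) <= p x + p y) /\
  (forall a x, 0 <= a -> p (a *: x) <= a * p x).

Lemma sublinear0 p : sublinear p -> p 0 = 0.
Proof.
move=> [pD pZ]; apply/eqP; rewrite eq_le; apply/andP; split.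
  by have := pZ 0 0 (lexx 0); rewrite scale0r mul0r.
by have := pD 0 0; rewrite addr0 lerDl.
Qed.

Lemma sublinearZ p a x : sublinear p -> 0 <= a -> p (a *: x) = a * p x.
Proof.
move=> sp; have [_ pZ] := sp; rewrite le_eqVlt => /predU1P[<-|a_gt0].
  by rewrite scale0r mul0r sublinear0.
apply/eqP; rewrite eq_le (pZ _ _ (ltW a_gt0))/= -ler_pdivlMl//.
have aV_ge0 : 0 <= a^-1 by rewrite invr_ge0 ltW.
by have := pZ _ (a *: x) aV_ge0; rewrite scalerA mulVf ?scale1r// gt_eqF.
Qed.

Lemma sublinear_geN p x : sublinear p -> - p (- x) <= p x.
Proof.
move=> sp; have [pD _] := sp; have := pD x (- x).
by rewrite subrr sublinear0// -subr_ge0 subr0 -lerBlDr sub0r.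
Qed.

(** Serves two pointwise infima: over a parameter in [sublinear_lower] and over a chain in
    [sublinear_minimal]. The closure conditions hold only up to decrease, which is all an infimum
    sees. *)
Lemma sublinear_inf (D : V -> set R) :
  (forall x, has_inf (D x)) ->
  (forall x y u v, D x u -> D y v -> exists2 w, D (x + y) w & w <= u + v) ->
  (forall a x u, 0 <= a -> D x u -> exists2 w, D (a *: x) w & w <= a * u) ->
  sublinear (fun x => inf (D x)).
Proof.
move=> Dinf DD DZ; split=> [x y|a x a0].
  rewrite -lerBlDr; apply: lb_le_inf => [|u Du]; first by case: (Dinf x).
  rewrite lerBlDr -lerBlDl; apply: lb_le_inf => [|v Dv].
    by case: (Dinf y).
  rewrite lerBlDl; have [w Dw /(le_trans _)] := DD _ _ _ _ Du Dv; apply.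
  by apply: ge_inf => //; case: (Dinf (x + y)).
have infZ u : D x u -> inf (D (a *: x)) <= a * u.
  move=> Du; have [w Dw /(le_trans _)] := DZ _ _ _ a0 Du; apply.
  by apply: ge_inf => //; case: (Dinf (a *: x)).
have [u Du] : D x !=set0 by case: (Dinf x).
have [a_eq0|a_neq0] := eqVneq a 0.
  by move: (infZ u Du); rewrite a_eq0 !mul0r.
have a_gt0 : 0 < a by rewrite lt_def a_neq0.
rewrite -ler_pdivrMl//; apply: lb_le_inf => [|v Dv]; first by exists u.
by rewrite ler_pdivrMl// infZ.
Qed.

(* For a minimal [q] the conclusion forces [q (- z) = - q z], which is how
   minimal sublinear functionals turn out to be linear. *)
Lemma sublinear_lower q z : sublinear q ->
  exists q', [/\ sublinear q', forall x, q' x <= q x & q' (- z) <= - q z].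
Proof.
move=> sq; have [qD qZ] := sq.
(* The functional sought is [inf (D x)]: the value at [t = 0] puts it below [q], and the value at
   [t = 1] gives the bound at [- z]. *)
pose D x := [set q (x + t *: z) - t * q z | t in [set t | 0 <= t]].
have D_ge x t : 0 <= t -> - q (- x) <= q (x + t *: z) - t * q z.
  move=> t0; have := qD (x + t *: z) (- x).
  by rewrite addrAC subrr add0r (sublinearZ _ sq t0); lra.
have Dinf x : has_inf (D x).
  split; first by exists (q (x + 0 *: z) - 0 * q z), 0 => /=.
  by exists (- q (- x)) => _ [t /= t0 <-]; exact: D_ge.
exists (fun x => inf (D x)); split.
- apply: sublinear_inf => // [x y _ _ [s s0 <-] [t t0 <-]|a x _ a0 [t t0 <-]].
    exists (q (x + y + (s + t) *: z) - (s + t) * q z).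
      by exists (s + t) => //=; rewrite addr_ge0.
    by rewrite mulrDl opprD addrACA lerD2r scalerDl addrACA.
  exists (q (a *: x + (a * t) *: z) - (a * t) * q z).
    by exists (a * t) => //=; rewrite mulr_ge0.
  by rewrite mulrBr mulrA lerD2r -scalerA -scalerDr qZ.
- move=> x; apply: ge_inf; first by case: (Dinf x).
  by exists 0 => //=; rewrite scale0r addr0 mul0r subr0.
- apply: ge_inf; first by case: (Dinf (- z)).
  by exists 1 => //=; rewrite scale1r addNr sublinear0// mul1r add0r.
Qed.

(** Zorn's lemma for the reversed pointwise order on the sublinear functionals below [p]. *)
Lemma sublinear_minimal p : sublinear p -> exists q,
  [/\ sublinear q, forall x, q x <= p x &
      forall r, sublinear r -> (forall x, r x <= q x) -> r = q].
Proof.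
move=> sp; pose T := {q : V -> R | sublinear q /\ forall x, q x <= p x}.
pose ge_T (q r : T) := `[< forall x, sval r x <= sval q x >].
have [||||[q [sq qp]] qmin] := @Zorn T ge_T.
- by move=> q; apply/asboolP.
- move=> q r s /asboolP rq /asboolP sr; apply/asboolP => x.
  exact: le_trans (rq x).
- move=> [q Pq] [r Pr] /asboolP/= rq /asboolP/= qr; apply/eq_exist/funext => x.
  by apply/eqP; rewrite eq_le rq qr.
(* The empty chain is bounded by [p]. A nonempty one is bounded by its pointwise infimum, finite
   because each member is at least [- p (- x)] at [x]. *)
- move=> A Atot; have [[q0 Aq0]|A0] := pselect (A !=set0); last first.
    by exists (exist _ p (conj sp (fun=> lexx _))) => s As; case: A0; exists s.
  pose D x := [set sval q x | q in A].
  have Dinf x : has_inf (D x).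
    split; first by exists (sval q0 x), q0.
    exists (- p (- x)) => _ [[q [sq qp]] _ <-] /=.
    by apply: le_trans (sublinear_geN x sq); rewrite lerN2 qp.
  have D_le (q : T) x : A q -> inf (D x) <= sval q x.
    by move=> Aq; apply: ge_inf; [case: (Dinf x)|exists q].
  have sinf : sublinear (fun x => inf (D x)).
    apply: sublinear_inf => // [x y _ _ [q Aq <-] [r Ar <-]|a x _ a0 [q Aq <-]].
      (* The smaller of the two members of the chain is the witness at [x + y]. *)
      have [/asboolP rq|/asboolP qr] := Atot _ _ Aq Ar.
        exists (sval r (x + y)); first by exists r.
        case: r {Ar} rq => r [[rD _] _] /= rq.
        by rewrite (le_trans (rD _ _))// lerD2r.
      exists (sval q (x + y)); first by exists q.
      case: q {Aq} qr => q [[qD _] _] /= qr.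
      by rewrite (le_trans (qD _ _))// lerD2l.
    exists (sval q (a *: x)); first by exists q.
    by case: q {Aq} => q [[_ qZ] _] /=; exact: qZ.
  have infp x : inf (D x) <= p x.
    by apply: le_trans (D_le _ x Aq0) _; case: q0 {Aq0} => q [].
  exists (exist _ (fun x => inf (D x)) (conj sinf infp)) => q Aq.
  by apply/asboolP => x /=; exact: D_le.
exists q; split=> // r sr rq.
have rp x : r x <= p x by exact: le_trans (qp x).
have /qmin/(congr1 sval)// : ge_T (exist _ q (conj sq qp))
  (exist _ r (conj sr rp)) by exact/asboolP.
Qed.

(** Lowering [p] at [z] before minimising forces equality there: [f (- z) <= p' (- z) <= - p z],
    while [f z <= p z]. *)
Lemma hahn_banach p z : sublinear p -> exists f : V -> R^o,
  [/\ linear f, forall x, f x <= p x & f z = p z].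
Proof.
move=> sp; have [p' [sp' p'p p'z]] := sublinear_lower z sp.
have [f [sf fp' fmin]] := sublinear_minimal sp'.
have [fD _] := sf.
have fN x : f (- x) = - f x.
  (* By minimality [f' = f], so [f (- x) <= - f x]; the converse inequality is subadditivity. *)
  have [f' [sf' f'f f'x]] := sublinear_lower x sf.
  apply/eqP; rewrite eq_le -{1}(fmin _ sf' f'f) f'x/=.
  by have := sublinear_geN (- x) sf; rewrite opprK.
have fDE x y : f (x + y) = f x + f y.
  apply/eqP; rewrite eq_le fD/=.
  by rewrite -lerN2 opprD -!fN opprD fD.
have fZE a x : f (a *: x) = a * f x.
  have [a0|/ltW a0] := leP 0 a; first exact: sublinearZ.
  by rewrite -[a]opprK scaleNr fN (sublinearZ _ sf) ?oppr_ge0// !mulNr.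
exists f; split=> [a x y|x|]; first by rewrite fDE fZE.
  exact: le_trans (fp' x) (p'p x).
apply/eqP; rewrite eq_le (le_trans (fp' z) (p'p z))/=.
by rewrite -lerN2 -fN (le_trans (fp' _) p'z).
Qed.

End hahn_banach.

(** * Bounded functionals and separation of points by the dual *)

Section bounded_functionals.
Context {R : realType}.
Implicit Types X Y Z : normedModType R.

Lemma bounded_pred_linear_le X Y (f : X -> Y) (C : R) :
  linear f -> (forall x, `|f x| <= C * `|x|) -> f \in bounded_pred.
Proof.
move=> lin_f f_le.
pose g : {linear X -> Y} := HB.pack f (GRing.isLinear.Build _ _ _ _ _ lin_f).
apply/bounded_predP; split=> //.
apply: (@bounded_linear_continuous _ _ _ g); apply/linear_boundedP.
exists C; split=> [|r Cr x]; first exact: num_real.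
by apply: le_trans (f_le x) _; rewrite ler_wpM2r// ltW.
Qed.

Lemma bounded_pred_comp X Y Z (g : 'L(Y, Z)) (f : 'L(X, Y)) :
  g \o f \in bounded_pred.
Proof.
apply/bounded_predP; split=> [a x y|x]; first by rewrite /= !linearP.
by apply: continuous_comp; exact: bounded_continuous.
Qed.

Definition bounded_comp X Y Z (g : 'L(Y, Z)) (f : 'L(X, Y)) : 'L(X, Z) :=
  BoundedOperator (bounded_pred_comp g f).

(** Hahn-Banach with the norm as sublinear functional. The bound is pointwise because [|f| = 1] is
    impossible when [X] is the zero space. *)
Lemma norming_functional X (x : X) :
  exists f : 'L(X, R^o), (forall y, `|f y| <= `|y|) /\ f x = `|x|.
Proof.
have [|f [lin_f f_le fx]] := @hahn_banach R X (fun y => `|y|) x.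
  split=> [y z|a y a0]; first exact: ler_normD.
  by rewrite normrZ ger0_norm.
have lef y : `|f y| <= `|y|.
  have fN : f (- y) = - f y.
    have := lin_f (-1) y 0; rewrite !addr0 !scaleN1r => ->.
    have := lin_f (-1) 0 0; rewrite scaler0 addr0 scaleN1r addNr => ->.
    by rewrite addr0.
  by rewrite ler_norml f_le andbT -lerN2 opprK -fN -[leRHS]normrN f_le.
have fb : f \in bounded_pred.
  by apply: (@bounded_pred_linear_le _ _ _ 1) => // y; rewrite mul1r lef.
by exists (BoundedOperator fb).
Qed.

Lemma dual_separates X (x y : X) : (forall f : 'L(X, R^o), f x = f y) -> x = y.
Proof.
move=> fxy; have [f [_ fE]] := norming_functional (x - y).
by apply/eqP; rewrite -subr_eq0 -normr_eq0 -fE linearB/= fxy subrr.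
Qed.

End bounded_functionals.

(** * Convergence along ultrafilters in compact sets *)

Section ultrafilters.

Lemma ultra_fmap (I T : Type) (f : I -> T) (F : set_system I) :
  UltraFilter F -> UltraFilter (f @ F).
Proof.
move=> FU; split=> [|G GF FG]; first exact: fmap_proper_filter.
rewrite predeqE => A; split=> [GA|]; last exact: FG.
have [//|FnA] := in_ultra_setVsetC (f @^-1` A) FU.
have GnA : G (~` A) by apply: FG.
by have /filter_ex[? []] : G (A `&` ~` A) by exact: filterI.
Qed.

Lemma ultra_compact_cvg (I : Type) (T : topologicalType) (F : set_system I)
    (A : set T) (f : I -> T) :
  UltraFilter F -> compact A -> (forall i, A (f i)) ->
  exists2 x, A x & f @ F --> x.
Proof.
move=> FU; rewrite compact_ultra => cA Af.
have FfA : F (f @^-1` A) by apply: filterS filterT => i _; exact: Af.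
by have [x [Ax fx]] := cA _ (ultra_fmap f FU) FfA; exists x.
Qed.

End ultrafilters.

(** * Weak limits in reflexive spaces and their images under compact operators *)

Section weak_limits.
Context {R : realType} {X : normedModType R}.
Context {I : Type} {F : set_system I} {FU : UltraFilter F}.
Variable x_ : I -> X.
Hypothesis x_le1 : forall i, `|x_ i| <= 1.

(* The limits along [F] of bounded functionals form an element of the bidual,
   which reflexivity represents by a vector. *)
Lemma reflexive_ultra_weak_cvg : reflexive_space X ->
  exists2 z : X, `|z| <= 1 &
    forall f : 'L(X, R^o), f (x_ i) @[i --> F] --> f z.
Proof.
move=> X_refl.
have lim_f (f : 'L(X, R^o)) :
    exists2 l : R^o, `|l| <= `|f| & f (x_ i) @[i --> F] --> l.
  have [|l] := @ultra_compact_cvg I R F `[- `|f|, `|f|]%classic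
    (fun i => f (x_ i)) FU (@segment_compact R _ _).
    by move=> i; rewrite /= in_itv/= -ler_norml; exact: le_opnorm1.
  by rewrite /= in_itv/= -ler_norml; exists l.
(* [L f] is the limit of [f (x_ i)]; the [match] only turns [exists2] into a conjunction, as
   [choice] expects. *)
have [L L_lim] := choice (fun f => let: ex_intro2 l l1 l2 := lim_f f in
  ex_intro (fun l : R^o => `|l| <= `|f| /\ f (x_ i) @[i --> F] --> l)
    l (conj l1 l2)).
have linL : linear L.
  move=> a f g; have [_ Lf] := L_lim f; have [_ Lg] := L_lim g.
  have [_ Lfg] := L_lim (a *: f + g).
  by apply: (norm_cvg_unique Lfg); exact: cvgD (cvgZr Lf) Lg.
have Lb : L \in bounded_pred.
  apply: (@bounded_pred_linear_le _ _ _ _ 1) => // f.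
  by rewrite mul1r; case: (L_lim f).
have [z _ zL] : range (bidual_embedding (X := X)) (BoundedOperator Lb).
  by rewrite X_refl.
have fzE (f : 'L(X, R^o)) : f z = L f.
  by rewrite -[LHS]/(bidual_embedding z f) zL.
exists z => [|f]; last by rewrite fzE; case: (L_lim f).
(* With [f] norming [z], [|z| = f z = L f] is at most [|f| <= 1]. *)
have [f [f_le fz]] := norming_functional z.
have f_le1 : `|f| <= 1.
  by apply: (@opnorm_le _ _ _ f) => x x1; exact: le_trans (f_le x) x1.
by rewrite -[leLHS]normr_id -fz fzE (le_trans _ f_le1)//; case: (L_lim f).
Qed.

(** Compactness gives a norm limit [y] of [S (x_ i)]. Each [g \o S] is a bounded functional on [X],
    so weak convergence yields [g y = g (S z)], and the dual separates points. *)
Lemma compact_weak_cvg (Y : normedModType R) (S : 'K(X, Y)) (z : X) :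
  (forall f : 'L(X, R^o), f (x_ i) @[i --> F] --> f z) ->
  S (x_ i) @[i --> F] --> S z.
Proof.
move=> xz; have [K SK [cK _]] := compact_predP _ (compact_valP S).
have [|y _ Sy] := ultra_compact_cvg (f := fun i => S (x_ i)) FU cK.
  by move=> i; apply: SK; exists (x_ i) => //; exact: x_le1.
suff -> : S z = y by [].
apply: dual_separates => g.
have gSx := xz (bounded_comp g S).
apply: (norm_cvg_unique gSx).
exact: (continuous_cvg _ (@bounded_continuous _ _ _ g y) Sy).
Qed.

End weak_limits.

(** * Rank-one operators *)

Section rank_one.
Context {R : realType} {X Y : normedModType R}.
Implicit Types (f : 'L(X, R^o)) (y : Y).

Lemma rank_one_bounded f y : (fun x => f x *: y) \in @bounded_pred R X Y.
Proof.
apply/bounded_predP; split=> [a u v|x].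
  by rewrite linearP scalerDl scalerA.
by apply: cvgZl; exact: bounded_continuous.
Qed.

Lemma rank_one_compact f y :
  BoundedOperator (rank_one_bounded f y) \in compact_pred.
Proof.
pose K := (fun a : R => a *: y) @` `[- `|f|, `|f|]%classic.
have cK : compact K.
  apply: continuous_compact; last exact: segment_compact.
  by apply: continuous_subspaceT => a; apply: cvgZl; exact: cvg_id.
apply/compact_predP; exists K.
  move=> _ [x x1 <-]; exists (f x) => //=.
  by rewrite in_itv/= -ler_norml; exact: le_opnorm1.
by split=> //; apply: compact_closed => //; exact: norm_hausdorff.
Qed.

Definition rank_one f y : 'K(X, Y) := CompactOperator (rank_one_compact f y).

End rank_one.

(** * Support functionals at [T] are controlled by values at [x0] *)

Section support_functionals.
Context {R : realType} {X Y : normedModType R}.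
Variables (T : 'K(X, Y)) (x0 : X).
Hypothesis X_reflexive : reflexive_space X.
Hypothesis T_neq0 : T != 0.
Hypothesis T_attains :
  [set x | unit_sphere X x /\ `|T x| = `|T|] = [set x0; - x0].

Lemma almost_norming (S : 'K(X, Y)) (e : R) : 0 < e ->
  exists2 x : X, `|x| <= 1 & `|S| - e < `|S x|.
Proof.
move=> e0; have [_ [x x1 <-] Sx] := sup_adherent e0 (opnorm_has_sup S).
by exists x.
Qed.

Lemma support_functional_le (f : 'L('K(X, Y), R^o)) (S : 'K(X, Y)) :
  `|f| <= 1 -> f T = `|T| -> f S <= `|S x0|.
Proof.
move=> f1 fT.
(* The error [t ^+ 2] still tends to 0 after division by [t]. For [t <= 0] nothing is asked and 0
   serves, so that [choice] yields a total function. *)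
have ex_x (t : R) : exists x : X,
    `|x| <= 1 /\ (0 < t -> `|T + t *: S| - t ^+ 2 < `|T x + t *: S x|).
  have [t0|t0] := leP t 0; first by exists 0; rewrite normr0; split=> //; lra.
  have [x x1 Sx] := almost_norming (T + t *: S) (exprn_gt0 2 t0).
  by exists x.
have [x_ x_P] := choice ex_x.
have x_le1 t : `|x_ t| <= 1 by case: (x_P t).
have [F [FU F0]] := ultraFilterLemma (at_right_proper_filter (0 : R)).
have [z z1 xz] := reflexive_ultra_weak_cvg x_le1 X_reflexive.
have cvg_S' (S' : 'K(X, Y)) : `|S' (x_ t)| @[t --> F] --> `|S' z|.
  by apply: cvg_norm; exact: compact_weak_cvg.
have Tz := cvg_S' T; have Sz := cvg_S' S.
have t_cvg : (t : R) @[t --> F] --> (0 : R).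
  apply: cvg_trans (cvg_at_right_filter (f := id) (@cvg_id _ (nbhs (0 : R)))).
  exact: F0.
have F_gt0 : \forall t \near F, 0 < t by apply: F0; exact: nbhs_right_gt.
have key (t : R) : 0 < t ->
    `|T| + t * f S - t ^+ 2 <= `|T (x_ t)| + t * `|S (x_ t)|.
  move=> t0; have [_ /(_ t0)/ltW xt] := x_P t.
  have : `|T| + t * f S <= `|T + t *: S|.
    have -> : `|T| + t * f S = f (T + t *: S) by rewrite linearD linearZ/= fT.
    apply: le_trans (ler_norm _) _; apply: le_trans (le_opnorm f _) _.
    by rewrite ler_piMl.
  have := ler_normD (T (x_ t)) (t *: S (x_ t)); rewrite normrZ (gtr0_norm t0).
  lra.
have T_le x : `|T x| <= `|T| * `|x| by exact: le_opnorm.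
(* Limit of [key] as [t] tends to 0. *)
have T_le_Tz : `|T| <= `|T z|.
  have lim_T : `|T (x_ t)| + t * `|S (x_ t)| - t * f S + t * t @[t --> F]
      --> `|T z| + 0 * `|S z| - 0 * f S + 0 * 0.
    exact: (cvgD (cvgB (cvgD Tz (cvgM t_cvg Sz)) (cvgM t_cvg (cvg_cst _)))
      (cvgM t_cvg t_cvg)).
  rewrite !mul0r subr0 !addr0 in lim_T.
  apply: (cvgr_to_ge lim_T); apply: filterS F_gt0 => t /key; lra.
(* Here [|T (x_ t)| <= |T|] cancels the leading terms of [key]; division by [t] precedes the
   limit. *)
have fS_le : f S <= `|S z|.
  have lim_S : `|S (x_ t)| + t @[t --> F] --> `|S z| + 0 by exact: cvgD.
  rewrite addr0 in lim_S.
  apply: (cvgr_to_ge lim_S); apply: filterS F_gt0 => t t0.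
  have := key t t0; have := T_le (x_ t).
  have := ler_piMr (normr_ge0 T) (x_le1 t) => h1 h2 h3.
  rewrite -(ler_pM2l t0); lra.
have T_gt0 : 0 < `|T| by rewrite normr_gt0.
have z_unit : `|z| = 1.
  apply/eqP; rewrite eq_le z1/= -(ler_pM2l T_gt0) mulr1.
  exact: le_trans T_le_Tz (T_le z).
have : [set x | unit_sphere X x /\ `|T x| = `|T|] z.
  split=> //; apply/eqP; rewrite eq_le T_le_Tz andbT.
  by have := T_le z; rewrite z_unit mulr1.
by rewrite T_attains => -[zE|zE]; move: fS_le; rewrite zE// linearN normrN.
Qed.

(** The one-sided bound is applied to [S - S'] and to its opposite, both of which vanish at [x0]. *)
Lemma support_functional_eq (f : 'L('K(X, Y), R^o)) (S S' : 'K(X, Y)) :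
  `|f| <= 1 -> f T = `|T| -> S x0 = S' x0 -> f S = f S'.
Proof.
move=> f1 fT SS'; apply/eqP; rewrite -subr_eq0 eq_le.
have D0 : (S - S') x0 = 0 by rewrite -[LHS]/(S x0 - S' x0) SS' subrr.
rewrite -linearB/= -oppr_le0 -linearN/=; apply/andP; split.
  by have := support_functional_le (S - S') f1 fT; rewrite D0 normr0.
have := support_functional_le (- (S - S')) f1 fT.
by rewrite -[(- (S - S')) x0]/(- ((S - S') x0)) D0 oppr0 normr0.
Qed.

End support_functionals.

(** * The support functional at [T] and its uniqueness *)

Lemma eval_compose_bounded (R : realType) (X Y : normedModType R)
    (g : 'L(Y, R^o)) (x : X) :
  (fun S : 'K(X, Y) => g (S x) : R^o) \in bounded_pred.
Proof.
apply: (@bounded_pred_linear_le _ _ _ _ (`|g| * `|x|)) => [a S S'|S].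
  by rewrite -[(a *: S + S') x]/(a *: S x + S' x) linearP.
apply: le_trans (le_opnorm g _) _; rewrite -mulrA ler_wpM2l ?opnorm_ge0//.
by rewrite [`|x| * _]mulrC; exact: le_opnorm.
Qed.

Theorem theorem4p1 (R : realType) (X : completeNormedModType R)
    (Y : normedModType R) (T : 'K(X, Y)) (x0 : X)
    (X_reflexive : reflexive_space X)
    (x0_unit : unit_sphere X x0)
    (T_attains : [set x | unit_sphere X x /\ `|T x| = `|T|] = [set x0; - x0])
    (Tx0_smooth : smooth_point (T x0)) :
  smooth_point T.
Proof.
have [Tx0_neq0 [g [[g1 gTx0] g_unique]]] := Tx0_smooth.
have TE : `|T x0| = `|T|.
  suff : [set x | unit_sphere X x /\ `|T x| = `|T|] x0 by case.
  by rewrite T_attains; left.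
have T_neq0 : T != 0 by rewrite -normr_gt0 -TE normr_gt0.
have T_gt0 : 0 < `|T| by rewrite normr_gt0.
have norm1 (Z : normedModType R) (h : 'L(Z, R^o)) (u : Z) :
    u != 0 -> h u = `|u| -> (forall v, `|h v| <= `|v|) -> `|h| = 1.
  move=> u0 hu h_le; apply/eqP; rewrite eq_le; apply/andP; split.
    by apply: (@opnorm_le _ _ _ h) => v v1; exact: le_trans (h_le v) v1.
  rewrite -(@ler_pM2r _ `|u|) ?normr_gt0// mul1r.
  by apply: le_trans (le_opnorm h u); rewrite hu normr_id.
split=> //; exists (BoundedOperator (eval_compose_bounded g x0)); split.
  split; last by rewrite /= gTx0 TE.
  apply: (norm1 _ _ T) => // [|S]; first by rewrite /= gTx0 TE.
  apply: le_trans (le_opnorm g _) _; rewrite -[opnorm g]/(`|g|) g1 mul1r.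
  by apply: le_trans (le_opnorm S _) _; rewrite x0_unit mulr1.
move=> f [f1 fT]; have f_le1 : `|f| <= 1 by rewrite f1.
apply: val_inj; apply/funext => S /=.
have f_le S' :=
  support_functional_le X_reflexive T_neq0 T_attains S' f_le1 fT.
have f_eq S1 S2 :=
  support_functional_eq X_reflexive T_neq0 T_attains (S := S1) (S' := S2)
    f_le1 fT.
(* The factor [|T|^-1] makes [phi x0 = 1], so [rank_one phi y] sends [x0] to [y]. *)
pose phi : 'L(X, R^o) := `|T|^-1 *: bounded_comp g T.
have phix0 : phi x0 = 1.
  by rewrite -[LHS]/(`|T|^-1 * g (T x0)) gTx0 TE mulVf// gt_eqF.
have rank_oneE y : rank_one phi y x0 = y.
  by rewrite -[LHS]/(phi x0 *: y) phix0 scale1r.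
pose h y : R^o := f (rank_one phi y).
(* Both sides are values of [f] at operators that agree at [x0]. *)
have lin_h : linear h.
  move=> a y y'; rewrite /h -linearP; apply: f_eq.
  by rewrite -[RHS]/(a *: rank_one phi y x0 + rank_one phi y' x0) !rank_oneE.
have h_le y : `|h y| <= `|y|.
  rewrite ler_norml; apply/andP; split; last first.
    by have := f_le (rank_one phi y); rewrite rank_oneE.
  have Nx0 : (- rank_one phi y) x0 = - y.
    by rewrite -[LHS]/(- rank_one phi y x0) rank_oneE.
  by have := f_le (- rank_one phi y); rewrite Nx0 normrN linearN/= lerNl.
have h_bounded : h \in bounded_pred.
  by apply: (@bounded_pred_linear_le _ _ _ _ 1) => // y; rewrite mul1r.
have hTx0 : h (T x0) = `|T x0|.
  by rewrite TE -fT; apply: f_eq; rewrite rank_oneE.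
(* Smoothness of [T x0] enters here: [h] has norm one and attains it at [T x0]. *)
have -> : g = BoundedOperator h_bounded.
  by apply: g_unique; split=> //; exact: (norm1 _ _ (T x0)).
(* [S] and [rank_one phi (S x0)] agree at [x0]. *)
by rewrite /= /h; apply: f_eq; rewrite rank_oneE.
Qed.
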